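(* Let $0\le b_1\le b_2<\infty$ with $b_2>0$. (i) If $b_2\le1$, then $\mathcal{I}(0)=+\infty$. (ii) If $b_2>1$, then $\mathcal{I}(0)=\dfrac{1}{2\sqrt{b_2}}\log\dfrac{\sqrt{b_2}+1}{\sqrt{b_2}-1}$, and the only structure in $\mathrm{Ad}$ having a quasi-eigenvalue at $\mathrm{i}\,\mathcal{I}(0)$ is $B\equiv b_2$ (i.e. $B(x)=b_2$ for a.a. $x$).
   Context: $\mathrm{Ad}:=\{B\in L^\infty_{\mathbb{R}}(0,1): b_1\le B(x)\le b_2 \text{ for a.a. } x\in(0,1)\}$. For $B\in L^\infty(0,1)$, a number $\kappa\in\mathbb{C}$, $\kappa\ne0$, is called a quasi-eigenvalue of $B$ if there is a nonzero solution $y\in W^{2,\infty}_{\mathbb{C}}[0,1]$ of $y''(x)+\kappa^2B(x)y(x)=0$ for a.a. $x\in(0,1)$ with $y'(0)=0$ and $y(1)-\mathrm{i}\,y'(1)/\kappa=0$. $K(B)$ denotes the set of all quasi-eigenvalues of $B$, and $K(\mathrm{Ad}):=\bigcup_{B\in\mathrm{Ad}}K(B)$. For $\alpha\in\mathbb{R}$ put $\mathcal{I}(\alpha):=+\infty$ if there is no $\kappa\in K(\mathrm{Ad})$ with $\operatorname{Re}\kappa=\alpha$; otherwise $\mathcal{I}(\alpha):=\min\{\operatorname{Im}\kappa:\operatorname{Re}\kappa=\alpha,\ \kappa\in K(\mathrm{Ad})\}$ (this minimum is attained and positive). *)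

(* Defs.v *)
From HB Require Import structures.
From mathcomp Require Import all_boot all_order all_algebra.
From mathcomp Require Import complex.
From mathcomp Require Import all_classical all_reals all_analysis.

Set Implicit Arguments.
Unset Strict Implicit.
Unset Printing Implicit Defensive.
Import Order.TTheory GRing.Theory Num.Theory.
Import numFieldNormedType.Exports.

Local Open Scope classical_set_scope.
Local Open Scope ring_scope.
Local Open Scope complex_scope.

Section QuasiEigenvalues.
Context {R : realType}.
Implicit Types (f : R -> R) (u v : R -> R[i]) (B : R -> R).

Local Notation Re := (@complex.Re R).
Local Notation Im := (@complex.Im R).

Definition ae01 (P : R -> Prop) : Prop :=
  {ae (@lebesgue_measure R), forall x, x \in `]0, 1[ -> P x}.

(* Elements of L^infty(0,1) are handled through representatives, defined on
   all of R; the values outside ]0, 1[ are irrelevant. *)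
Definition Linfty f : Prop :=
  measurable_fun (`]0, 1[ : set R) f /\ exists M : R, ae01 (fun x => `|f x| <= M).

Definition LinftyC u : Prop := Linfty (fun x => Re (u x)) /\ Linfty (fun x => Im (u x)).

Definition integral01 u : R[i] :=
  (\int[lebesgue_measure]_(x in `]0, 1[) Re (u x))
  +i* (\int[lebesgue_measure]_(x in `]0, 1[) Im (u x)).

(* C_c^infty(0,1) *)
Definition test_function f : Prop :=
  [/\ forall (n : nat) (x : R), derivable (derive1n n f) x 1,
      compact (closure [set x | f x != 0]) &
      closure [set x | f x != 0] `<=` `]0, 1[].

Definition weak_derivative u v : Prop :=
  forall phi : R -> R, test_function phi ->
    integral01 (fun x => u x * (derive1 phi x)%:C)
    = - integral01 (fun x => v x * (phi x)%:C).

Definition continuous01 u : Prop :=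
  {within `[0, 1], continuous (fun x => Re (u x))} /\
  {within `[0, 1], continuous (fun x => Im (u x))}.

(* [y] belongs to W^{2,infty}_C[0,1] and has the distributional derivatives
   [y1] = y' and [y2] = y''. Among their almost-everywhere representatives, [y]
   and [y1] are the ones continuous on [0, 1]: these give the boundary values. *)
Definition W2infty (y y1 y2 : R -> R[i]) : Prop :=
  [/\ LinftyC y, LinftyC y1 & LinftyC y2] /\
  [/\ weak_derivative y y1, weak_derivative y1 y2,
      continuous01 y & continuous01 y1].

Definition quasi_eigenvalue B (kappa : R[i]) : Prop :=
  kappa != 0 /\
  exists y y1 y2 : R -> R[i],
    [/\ W2infty y y1 y2,
        exists2 x, x \in `[0, 1] & y x != 0,
        ae01 (fun x => y2 x + kappa ^+ 2 * (B x)%:C * y x = 0),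
        y1 0 = 0 &
        y 1 - (0 +i* 1) * y1 1 / kappa = 0].

Definition K B : set R[i] := [set kappa | quasi_eigenvalue B kappa].

Definition Ad (b1 b2 : R) : set (R -> R) :=
  [set B | Linfty B /\ ae01 (fun x => b1 <= B x <= b2)].

Definition KAd (b1 b2 : R) : set R[i] := \bigcup_(B in Ad b1 b2) K B.

Definition is_min (S : set R) (m : R) : Prop := S m /\ lbound S m.

(* The set of the [Im kappa] with [kappa] in [K(Ad)] and [Re kappa = alpha]. *)
Definition decay_rates (b1 b2 alpha : R) : set R :=
  [set Im kappa | kappa in [set kappa | Re kappa = alpha /\ KAd b1 b2 kappa]].

(* [xget] picks the minimum; its default value 0 is used only if a nonempty
   [decay_rates] has no minimum. *)
Definition minimal_decay (b1 b2 alpha : R) : \bar R :=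
  if `[< decay_rates b1 b2 alpha = set0 >] then +oo%E
  else (xget 0 (is_min (decay_rates b1 b2 alpha)))%:E.

End QuasiEigenvalues.

(* Main.v *)
Require Import Defs.
From HB Require Import structures.
From mathcomp Require Import all_boot all_order all_algebra.
From mathcomp Require Import complex.
From mathcomp Require Import all_classical all_reals all_analysis.
From mathcomp Require Import measurable_realfun.
From mathcomp Require Import ring lra.

Set Implicit Arguments.
Unset Strict Implicit.
Unset Printing Implicit Defensive.
Import Order.TTheory GRing.Theory Num.Theory.
Import numFieldNormedType.Exports.

Local Open Scope classical_set_scope.
Local Open Scope ring_scope.
Local Open Scope complex_scope.

(** On the imaginary axis, [kappa = i beta], the spectral problem is real: the
    real or the imaginary part of a mode is a nonzero real [u] with
    [u'' = beta^2 B u], [u'(0) = 0] and [u'(1) = beta u(1)]. Everything then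
    follows from two energy identities.

    Multiplying the equation by [u] and integrating gives
    [beta u(1)^2 = \int u'^2 + beta^2 B u^2], so that [beta > 0] and
    [u(1) <> 0] ([mode_energy]).

    Let [z] be the solution [cosh (omega x)], [omega = beta sqrt b2], of the
    equation for the constant structure [b2], and [v] its multiple with
    [v(1) = u(1)]. As a solution, [u] minimizes the energy
    [\int w'^2 + beta^2 B w^2] among the functions [w] with [w(1) = u(1)], and
    replacing [B] by [b2] can only increase the energy of [v]. Quantitatively
    ([mode_comparison]),
    [\int (v' - u')^2 + beta^2 B (v - u)^2 + beta^2 (b2 - B) v^2
      = u(1)^2 (z'(1) / z(1) - beta)].
    Hence [beta <= z'(1) / z(1) = beta sqrt b2 tanh (beta sqrt b2)], and in the
    case of equality the last term of the integrand forces [B = b2] almost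
    everywhere. The inequality [1 <= s tanh (beta s)], [s = sqrt b2], reads
    [s + 1 <= (s - 1) exp (2 beta s)] ([zmode_balance]): it is impossible for
    [s <= 1], and for [1 < s] it says that [beta] is at least the announced
    value. Conversely [z] is a mode of [b2] for that value of [beta].

    These computations need integration by parts up to the boundary for
    functions that only have weak derivatives. The notion used throughout is
    [primitive01 f f']: the increments of [f] over subintervals of [[0, 1]] are
    the integrals of the bounded function [f']. Such functions satisfy the
    product rule ([primitiveM]), and a continuous function with a bounded weak
    derivative is of this kind ([weak_derivative_primitive]): test functions
    close to the indicator of an interval turn the definition of the weak
    derivative into an increment formula. *)

Local Notation itg a b f := (Rintegral lebesgue_measure (`]a, b[ : set _) f).

(** * Integrals of bounded functions over subintervals of the unit interval *)

Section BoundedIntegrals.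
Context {R : realType}.
Implicit Types (f g h : R -> R) (a b c k M : R).
Local Notation mu := (@lebesgue_measure R).

#[local] Instance ae_filter_lebesgue : Filter (almost_everywhere mu) :=
  ae_filter_ringOfSetsType mu.

Lemma ae01_all (P : R -> Prop) : (forall x, 0 < x < 1 -> P x) -> ae01 P.
Proof. by move=> h; rewrite /ae01; apply: aeW => x; rewrite in_itv/= => /h. Qed.

Lemma ae01W (P Q : R -> Prop) :
  (forall x, 0 < x < 1 -> P x -> Q x) -> ae01 P -> ae01 Q.
Proof.
move=> PQ; rewrite /ae01; apply: filterS => x Px x01; apply: PQ; last exact: Px.
by rewrite in_itv/= in x01.
Qed.

Lemma ae01W2 (P Q S : R -> Prop) :
  (forall x, 0 < x < 1 -> P x -> Q x -> S x) -> ae01 P -> ae01 Q -> ae01 S.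
Proof.
move=> PQ; rewrite /ae01; apply: filterS2 => x Px Qx x01.
apply: PQ (Px x01) (Qx x01).
by rewrite in_itv/= in x01.
Qed.

Lemma ae01_ab (P : R -> Prop) a b : 0 <= a -> b <= 1 -> ae01 P ->
  {ae mu, forall x, `]a, b[%classic x -> P x}.
Proof.
move=> a0 b1; rewrite /ae01; apply: filterS => x Px.
rewrite /= in_itv/= => /andP[ax xb].
by apply: Px; rewrite in_itv/= (le_lt_trans a0)//= (lt_le_trans xb).
Qed.

Lemma Linfty_cst k : Linfty (fun=> k : R).
Proof. by split => //; exists `|k|; exact: ae01_all. Qed.

Lemma LinftyD f g : Linfty f -> Linfty g -> Linfty (fun x => f x + g x).
Proof.
move=> [mf [M fM]] [mg [N gN]]; split; first exact: measurable_funD.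
exists (M + N); apply: ae01W2 fM gN => x _ fM gN.
by rewrite (le_trans (ler_normD _ _))// lerD.
Qed.

Lemma LinftyM f g : Linfty f -> Linfty g -> Linfty (fun x => f x * g x).
Proof.
move=> [mf [M fM]] [mg [N gN]]; split; first exact: measurable_funM.
exists (M * N); apply: ae01W2 fM gN => x _ fM gN.
by rewrite normrM ler_pM.
Qed.

Lemma LinftyZ k f : Linfty f -> Linfty (fun x => k * f x).
Proof. exact/LinftyM/Linfty_cst. Qed.

Lemma LinftyB f g : Linfty f -> Linfty g -> Linfty (fun x => f x - g x).
Proof.
move=> Lf Lg; have := LinftyD Lf (LinftyZ (-1) Lg).
by congr Linfty; apply/funext => x; rewrite mulN1r.
Qed.

Lemma Linfty_continuous f : {within `[0, 1], continuous f} -> Linfty f.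
Proof.
move=> cf; split.
  have mf : measurable_fun (`[0, 1] : set R) f.
    exact: subspace_continuous_measurable_fun.
  by apply: measurable_funS mf => //; exact: subset_itv_oo_cc.
have [M [_ fM]] := compact_bounded (continuous_compact cf (@segment_compact _ 0 1)).
exists (M + 1); apply: ae01_all => x /andP[x0 x1].
apply: fM; first by rewrite ltrDl.
by exists x => //=; rewrite in_itv/= !ltW.
Qed.

Lemma Linfty_integrable f a b : 0 <= a -> b <= 1 -> Linfty f ->
  mu.-integrable `]a, b[ (EFin \o f).
Proof.
move=> a0 b1 [mf [M fM]]; have sab : `]a, b[ `<=` (`]0, 1[ : set R).
  by apply: subset_itv; rewrite bnd_simp.
suff: mu.-integrable `]0, 1[ (EFin \o f) by apply: integrableS.
apply/integrableP; split.
  exact/measurable_EFinP.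
apply: (@le_lt_trans _ _ (\int[mu]_(x in `]0%R, 1%R[) (`|M|)%:E)%E).
  apply: ae_ge0_le_integral => //=.
    by apply/measurable_EFinP; exact: measurableT_comp.
  apply: filterS (ae01_ab (lexx 0) (lexx 1) fM) => x + x01 => /(_ x01) fMx.
  by rewrite lee_fin (le_trans fMx)// ler_norm.
by rewrite integral_cst//= lebesgue_measure_itv/= lte_fin ltr01 -EFinD ltry.
Qed.

Section subinterval.
Variables a b : R.
Hypotheses (a0 : 0 <= a) (b1 : b <= 1).

Lemma intD f g : Linfty f -> Linfty g ->
  itg a b (fun x => f x + g x) = itg a b f + itg a b g.
Proof. by move=> Lf Lg; rewrite RintegralD//; exact: Linfty_integrable. Qed.

Lemma intB f g : Linfty f -> Linfty g ->
  itg a b (fun x => f x - g x) = itg a b f - itg a b g.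
Proof. by move=> Lf Lg; rewrite RintegralB//; exact: Linfty_integrable. Qed.

Lemma intZ k f : Linfty f -> itg a b (fun x => k * f x) = k * itg a b f.
Proof. by move=> Lf; rewrite RintegralZl//; exact: Linfty_integrable. Qed.

Lemma int_cst k : a <= b -> itg a b (fun=> k) = k * (b - a).
Proof.
move=> ab; rewrite Rintegral_cst//= lebesgue_measure_itv/= lte_fin.
move: ab; rewrite le_eqVlt => /predU1P[->|->//].
by rewrite ltxx subrr.
Qed.

Lemma int_eq f g : Linfty f -> Linfty g ->
  ae01 (fun x => a < x < b -> f x = g x) -> itg a b f = itg a b g.
Proof.
move=> Lf Lg fg; congr fine; apply: ae_eq_integral => //.
- by have /integrableP[] := Linfty_integrable a0 b1 Lf.
- by have /integrableP[] := Linfty_integrable a0 b1 Lg.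
- by apply: filterS (ae01_ab a0 b1 fg) => x fgx abx; rewrite fgx.
Qed.

Lemma int_ge0 f : Linfty f -> ae01 (fun x => a < x < b -> 0 <= f x) ->
  0 <= itg a b f.
Proof.
move=> Lf f0; rewrite (@int_eq f (fun x => `|f x|))//; last 2 first.
- case: Lf => mf [M fM]; split; first exact: measurableT_comp.
  by exists M; apply: ae01W fM => x _; rewrite normr_id.
- by apply: ae01W f0 => x _ + abx => /(_ abx)/ger0_norm.
exact: Rintegral_ge0.
Qed.

Lemma int_le f g : Linfty f -> Linfty g ->
  ae01 (fun x => a < x < b -> f x <= g x) -> itg a b f <= itg a b g.
Proof.
move=> Lf Lg fg; rewrite -subr_ge0 -intB//; apply: int_ge0.
  exact: LinftyB.
by apply: ae01W fg => x _ fgx abx; rewrite subr_ge0 fgx.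
Qed.

Lemma int_norm_le f M : a <= b -> Linfty f ->
  ae01 (fun x => a < x < b -> `|f x| <= M) -> `|itg a b f| <= M * (b - a).
Proof.
move=> ab Lf fM; rewrite -int_cst// ler_norml; apply/andP; split.
  rewrite -mulN1r -intZ; last exact: Linfty_cst.
  apply: int_le => //; first exact/LinftyZ/Linfty_cst.
  apply: ae01W fM => x _ + abx => /(_ abx).
  by rewrite mulN1r ler_norml => /andP[].
apply: int_le => //; first exact: Linfty_cst.
apply: ae01W fM => x _ + abx => /(_ abx).
by rewrite ler_norml => /andP[].
Qed.

End subinterval.

Lemma int_split a b c f : 0 <= a -> a <= c -> c <= b -> b <= 1 -> Linfty f ->
  itg a b f = itg a c f + itg c b f.
Proof.
move=> a0 ac cb b1 Lf.
move: ac; rewrite le_eqVlt => /predU1P[->|ac].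
  by rewrite set_itvoo0 Rintegral_set0 add0r.
have iab := Linfty_integrable a0 b1 Lf.
have c1 := le_trans cb b1.
have := @Rintegral_itvB R f (BRight a) (BLeft b) c iab.
rewrite -(@Rintegral_itv_bndo_bndc _ (BRight a) c); last first.
  exact: Linfty_integrable.
move: cb; rewrite le_eqVlt => /predU1P[->|cb].
  by rewrite set_itvoo0 Rintegral_set0 addr0.
by rewrite !bnd_simp => /(_ (ltW ac) cb) <-; rewrite addrC subrK.
Qed.

Lemma int_ge0_eq0 f : Linfty f -> ae01 (fun x => 0 <= f x) ->
  itg 0 1 f = 0 -> ae01 (fun x => f x = 0).
Proof.
move=> Lf f0 If.
have f2 := Linfty_integrable (lexx 0) (lexx 1) Lf.
have [mf _] := integrableP _ _ _ f2.
have [key _] := @ae_eq_integral_abs _ _ _ mu (`]0, 1[ : set R)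
  (measurable_itv _) _ mf.
suff /key : (\int[mu]_(x in (`]0%R, 1%R[ : set R)) `|(EFin \o f) x| = 0)%E.
  by rewrite /ae01; apply: filterS => x fx x01; have := fx x01; rewrite /= => -[].
transitivity (\int[mu]_(x in (`]0%R, 1%R[ : set R)) (f x)%:E)%E.
  apply: ae_eq_integral => //; first exact: measurableT_comp.
  apply: filterS (ae01_ab (lexx 0) (lexx 1) f0) => x + x01 => /(_ x01) fx0.
  by rewrite /= ger0_norm.
rewrite -(fineK (@integrable_fin_num _ _ _ mu _ (measurable_itv _) _ f2)).
by congr EFin.
Qed.

End BoundedIntegrals.

(** * Functions with a bounded derivative, in integral form *)

Section Primitives.
Context {R : realType}.
Implicit Types (f g : R -> R) (a b k C : R).
Local Notation mu := (@lebesgue_measure R).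

(** The functions that are Lipschitz on the unit interval, with a chosen
    representative of their derivative. *)
Definition primitive01 f f' : Prop :=
  Linfty f' /\ forall a b, 0 <= a -> a <= b -> b <= 1 -> f b - f a = itg a b f'.

Lemma primitive_lipschitz f f' : primitive01 f f' -> exists2 M, 0 <= M &
  forall a b, 0 <= a -> a <= b -> b <= 1 -> `|f b - f a| <= M * (b - a).
Proof.
move=> [Lf' ff']; have [_ [M f'M]] := Lf'.
exists `|M| => // a b a0 ab b1; rewrite ff'//; apply: int_norm_le => //.
by apply: ae01W f'M => x _ f'Mx _; rewrite (le_trans f'Mx)// ler_norm.
Qed.

Lemma primitive_continuous f f' : primitive01 f f' ->
  {within `[0, 1], continuous f}.
Proof.
move=> /primitive_lipschitz[M M0 lip].
have lip2 x y : 0 <= x <= 1 -> 0 <= y <= 1 -> `|f x - f y| <= M * `|x - y|.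
  move=> /andP[x0 x1] /andP[y0 y1]; have [xy|/ltW yx] := leP x y.
    by rewrite distrC [X in M * X]distrC [X in M * X]ger0_norm ?subr_ge0// lip.
  by rewrite [X in M * X]ger0_norm ?subr_ge0// lip.
have M1 : 0 < M + 1 by rewrite ltr_wpDl.
apply/subspace_continuousP => x /=; rewrite in_itv/= => x01.
apply/cvgrPdist_le => e e0; rewrite near_withinE; near=> y => /=.
rewrite in_itv/= => y01; apply: (le_trans (lip2 _ _ x01 y01)).
apply: (@le_trans _ _ ((M + 1) * `|x - y|)).
  by rewrite ler_wpM2r// lerDl.
rewrite mulrC -ler_pdivlMr//; near: y.
apply/nbhs_ballP; exists (e / (M + 1)); first exact: divr_gt0.
by move=> z; rewrite -ball_normE /= => /ltW.
Unshelve. all: by end_near. Qed.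

Lemma primitive_Linfty f f' : primitive01 f f' -> Linfty f.
Proof. by move=> /primitive_continuous; exact: Linfty_continuous. Qed.

(** Cutting an interval into two halves divides the bound on its increment by
    two, and this can be iterated. *)
Lemma quadratic_increments_cst f C :
  (forall a b, 0 <= a -> a <= b -> b <= 1 -> `|f b - f a| <= C * (b - a) ^+ 2) ->
  forall a b, 0 <= a -> a <= b -> b <= 1 -> f b = f a.
Proof.
move=> fC.
have halve n : forall a b, 0 <= a -> a <= b -> b <= 1 ->
    `|f b - f a| * 2 ^+ n <= C * (b - a) ^+ 2.
  elim: n => [a b a0 ab b1|n IH a b a0 ab b1]; first by rewrite mulr1 fC.
  pose m := (a + b) / 2.
  have am : a <= m by rewrite /m; lra.
  have mb : m <= b by rewrite /m; lra.
  have := IH a m a0 am (le_trans mb b1).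
  have := IH m b (le_trans a0 am) mb b1.
  have -> : m - a = (b - a) / 2 by rewrite /m; field.
  have -> : b - m = (b - a) / 2 by rewrite /m; field.
  have tri : `|f b - f a| <= `|f b - f m| + `|f m - f a|.
    by rewrite -[f b - f a](subrKA (f m)) ler_normD.
  have p0 : 0 <= (2 : R) ^+ n by rewrite exprn_ge0.
  move: (ler_wpM2r p0 tri) => tri2 h1 h2.
  rewrite exprS (_ : C * _ = 2 * (C * ((b - a) / 2) ^+ 2 + C * ((b - a) / 2) ^+ 2)).
    lra.
  by field.
move=> a b a0 ab b1; apply/eqP; rewrite -subr_eq0 -normr_le0 leNgt.
apply/negP => d0; set d := `|f b - f a| in d0.
have C0 : 0 <= C * (b - a) ^+ 2 by apply: le_trans (fC a b a0 ab b1).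
pose n := Num.bound (C * (b - a) ^+ 2 / d).
have := halve n a b a0 ab b1; rewrite -/d leNgt => /negP; apply.
rewrite [X in _ < X]mulrC -ltr_pdivrMr//.
apply: (@lt_trans _ _ n%:R); last by rewrite -natrX ltr_nat ltn_expl.
by apply: archi_boundP; rewrite divr_ge0// ltW.
Qed.

(** Both factors are Lipschitz, so that the defect of the product rule over
    an interval is quadratic in its length. *)
Lemma primitiveM f f' g g' : primitive01 f f' -> primitive01 g g' ->
  primitive01 (fun x => f x * g x) (fun x => f' x * g x + f x * g' x).
Proof.
move=> pf pg.
have [Lf' ff'] := pf; have [Lg' gg'] := pg.
have Lf := primitive_Linfty pf; have Lg := primitive_Linfty pg.
have [M M0 fM] := primitive_lipschitz pf.
have [N N0 gN] := primitive_lipschitz pg.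
have [_ [M' f'M]] := Lf'; have [_ [N' g'N]] := Lg'.
set h := (fun x => f' x * g x + f x * g' x).
have Lh : Linfty h by apply: LinftyD; apply: LinftyM.
split=> //; pose D x := f x * g x - itg 0 x h.
suff Dcst a b : 0 <= a -> a <= b -> b <= 1 ->
    `|D b - D a| <= (M' * N + M * N') * (b - a) ^+ 2.
  move=> a b a0 ab b1; have := quadratic_increments_cst Dcst a0 ab b1.
  rewrite /D (@int_split _ 0 b a h)//= => /eqP.
  by rewrite subr_eq => /eqP ->; ring.
move=> a0 ab b1.
have -> : D b - D a = itg a b (fun x => f' x * (g b - g x) + (f a - f x) * g' x).
  have L1 : Linfty (fun x => g b * f' x + f a * g' x).
    by apply: LinftyD; exact: LinftyZ.
  have -> : (fun x => f' x * (g b - g x) + (f a - f x) * g' x) =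
      (fun x => (g b * f' x + f a * g' x) - h x).
    by apply/funext => x; rewrite /h; ring.
  rewrite intB// intD//; [|exact: LinftyZ|exact: LinftyZ].
  rewrite !intZ// -ff'// -gg'// /D (@int_split _ 0 b a h)//=.
  by ring.
rewrite expr2 mulrA; apply: int_norm_le => //.
  apply: LinftyD; apply: LinftyM => //; apply: LinftyB => //; exact: Linfty_cst.
apply: ae01W2 f'M g'N => x /andP[x0 x1] f'M g'N /andP[/ltW ax /ltW xb].
rewrite (le_trans (ler_normD _ _))// [leRHS]mulrDl !normrM lerD//.
  rewrite -mulrA ler_pM// (le_trans (gN _ _ (ltW x0) xb b1))// ler_wpM2l//.
  by rewrite lerD2l lerN2.
rewrite mulrAC ler_pM// distrC (le_trans (fM _ _ a0 ax (ltW x1)))// ler_wpM2l//.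
by rewrite lerD2r.
Qed.

Lemma primitiveD f f' g g' : primitive01 f f' -> primitive01 g g' ->
  primitive01 (fun x => f x + g x) (fun x => f' x + g' x).
Proof.
move=> [Lf ff'] [Lg gg']; split; first exact: LinftyD.
by move=> a b a0 ab b1; rewrite intD// -ff'// -gg'//; ring.
Qed.

Lemma primitiveZ k f f' : primitive01 f f' ->
  primitive01 (fun x => k * f x) (fun x => k * f' x).
Proof.
move=> [Lf ff']; split; first exact: LinftyZ.
by move=> a b a0 ab b1; rewrite intZ// -ff'//; ring.
Qed.

Lemma primitive_ae f f' g' : Linfty g' -> ae01 (fun x => f' x = g' x) ->
  primitive01 f f' -> primitive01 f g'.
Proof.
move=> Lg' fg [Lf' ff']; split=> // a b a0 ab b1; rewrite ff'//.
by apply: int_eq => //; apply: ae01W fg.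
Qed.

Lemma derivable_primitive f f' :
  (forall x, is_derive x (1 : R) f (f' x)) -> continuous f' -> primitive01 f f'.
Proof.
move=> df cf'; have Lf' : Linfty f'.
  by apply: Linfty_continuous; exact: continuous_subspaceT.
have cf : continuous f.
  move=> x; apply/differentiable_continuous/derivable1_diffP.
  by case: (df x).
split=> // a b a0; rewrite le_eqVlt => /predU1P[->|ab] b1.
  by rewrite set_itvoo0 Rintegral_set0 subrr.
rewrite Rintegral_itv_bndo_bndc; last exact: Linfty_integrable.
have iab : mu.-integrable `[a, b] (EFin \o f').
  apply: continuous_compact_integrable; first exact: segment_compact.
  exact: continuous_subspaceT.
rewrite Rintegral_itv_obnd_cbnd; last first.
  by move: iab; apply: integrableS => //; exact: subset_itv_oc_cc.
rewrite /Rintegral (continuous_FTC2 ab (F := f))//.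
- exact: continuous_subspaceT.
- split; first by move=> x _; case: (df x).
    by apply: cvg_at_right_filter; exact: cf.
  by apply: cvg_at_left_filter; exact: cf.
- by move=> x _; rewrite derive1E; case: (df x).
Qed.

End Primitives.

(** * A smooth step *)

Section SmoothStep.
Context {R : realType}.
Implicit Types (f g h : R -> R) (p : {poly R}) (c d k x t : R).

(** For [p = 1] this is the standard smooth function whose zeros are the
    nonpositive numbers; the polynomials make the family stable under
    differentiation. *)
Definition flat p x : R := if 0 < x then p.[x^-1] * expR (- x^-1) else 0.

Lemma expR_decay (k : nat) t : 0 <= t -> t ^+ k * expR (- t) <= k`!%:R.
Proof.
move=> t0; case: k => [|k]; first by rewrite mul1r -[_%:R]expR0 ler_expR oppr_le0.
rewrite expRN ler_pdivrMr ?expR_gt0// -ler_pdivrMl ?ltr0n ?fact_gt0// mulrC.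
by rewrite (le_trans _ (expR_ge1Dxn k t0))// lerDr.
Qed.

(** The power [t ^+ k] absorbs the variable in the induction on [p]. *)
Lemma poly_expR_bounded p (k : nat) : exists2 C, 0 <= C &
  forall t, 0 <= t -> `|p.[t]| * (t ^+ k * expR (- t)) <= C.
Proof.
elim/poly_ind: p k => [|p c IH] k.
  by exists 0 => // t _; rewrite horner0 normr0 mul0r.
have [C C0 pC] := IH k.+1.
exists (C + `|c| * k`!%:R); first by rewrite addr_ge0// mulr_ge0.
move=> t t0; rewrite hornerMXaddC.
have e0 : 0 <= t ^+ k * expR (- t) by rewrite mulr_ge0 ?exprn_ge0// expR_ge0.
apply: (le_trans (ler_wpM2r e0 (ler_normD _ _))); rewrite mulrDl lerD//.
  by rewrite normrM (ger0_norm t0) -mulrA [t * (_ * _)]mulrA -exprS pC.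
by rewrite ler_wpM2l// expR_decay.
Qed.

Lemma flat_quadratic p : exists2 C, 0 <= C & forall x, `|flat p x| <= C * x ^+ 2.
Proof.
have [C C0 pC] := poly_expR_bounded p 2.
exists C => // x; rewrite /flat; case: ifPn => x0; last first.
  by rewrite normr0 mulr_ge0// sqr_ge0.
have := pC x^-1; rewrite invr_ge0 => /(_ (ltW x0)) {}pC.
rewrite normrM (ger0_norm (expR_ge0 _)).
rewrite -ler_pdivrMr ?exprn_gt0// (le_trans _ pC)//.
by rewrite -exprVn -mulrA [X in _ * X]mulrC.
Qed.

Lemma is_derive_flat p x :
  is_derive x (1 : R) (flat p) (flat ('X^2 * (p - p^`())) x).
Proof.
have [x0|x0|->] := ltgtP x 0.
- rewrite {2}/flat ltNge (ltW x0)/=.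
  apply: (@near_eq_is_derive _ _ _ (cst 0)); near=> y.
  by rewrite /flat ltNge ltW//=; near: y; exact: lt_nbhsl.
- have dV : is_derive x (1 : R) (fun y => y^-1) (- x ^- 2).
    by apply: is_derive_eq (is_deriveV _ _) _; [rewrite gt_eqF|exact: mulr1].
  have dp : is_derive x (1 : R) (fun y => p.[y^-1]) (p^`().[x^-1] * (- x ^- 2)).
    exact: (@is_derive1_comp _ (horner p) (fun y => y^-1)).
  have de : is_derive x (1 : R) (fun y => expR (- y^-1))
      (expR (- x^-1) * x ^- 2).
    apply: is_derive_eq (@is_derive1_comp _ expR (fun y => - y^-1) _ _ _ _ _) _.
    by rewrite opprK.
  apply: (@near_eq_is_derive R R^o R^o (fun y => p.[y^-1] * expR (- y^-1))).
    by near=> y; rewrite /flat ifT//; near: y; exact: lt_nbhsr.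
  apply: is_derive_eq (is_deriveM dp de) _.
  rewrite /flat x0 !hornerE/= /GRing.scale/= -exprVn; ring.
- rewrite {2}/flat ltxx; apply/is_derive1_caratheodory.
  have [C C0 pC] := flat_quadratic p.
  (* the difference quotient at 0 is of the order of [y] by [flat_quadratic] *)
  exists (fun y => flat p y / y); split.
  + move=> y; rewrite {2}/flat ltxx !subr0.
    have [->|y0] := eqVneq y 0; first by rewrite mulr0 /flat ltxx.
    by rewrite divfK.
  + rewrite /prop_for /continuous_at invr0 mulr0.
    have C1 : 0 < C + 1 by rewrite ltr_wpDl.
    apply/cvgrPdist_le => e e0; near=> y; rewrite sub0r normrN.
    have [->|y0] := eqVneq y 0; first by rewrite invr0 mulr0 normr0 ltW.
    rewrite normrM normfV ler_pdivrMr ?normr_gt0// (le_trans (pC y))//.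
    rewrite -real_normK ?num_real// expr2 mulrA ler_wpM2r//.
    apply: (@le_trans _ _ ((C + 1) * `|y|)); first by rewrite ler_wpM2r// lerDl.
    rewrite mulrC -ler_pdivlMr//; near: y.
    apply/nbhs_ballP; exists (e / (C + 1)); first exact: divr_gt0.
    by move=> z; rewrite /ball/= sub0r normrN => /ltW.
  + by rewrite invr0 mulr0.
Unshelve. all: by end_near. Qed.

(** A class of functions that contains a smooth step and is visibly closed
    under differentiation: its members are therefore smooth. *)
Inductive flat_expr : (R -> R) -> Prop :=
| flat_base p : flat_expr (flat p)
| flat_cst k : flat_expr (fun=> k)
| flat_affine f k c : flat_expr f -> flat_expr (fun x => f (k * x + c))
| flat_add f g : flat_expr f -> flat_expr g -> flat_expr (fun x => f x + g x)
| flat_mul f g : flat_expr f -> flat_expr g -> flat_expr (fun x => f x * g x)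
| flat_inv f : flat_expr f -> (forall x, f x != 0) ->
    flat_expr (fun x => (f x)^-1).

Lemma flat_expr_derive f : flat_expr f -> exists2 f', flat_expr f' &
  forall x, is_derive x (1 : R) f (f' x).
Proof.
elim=> {f} [p|k|f k c _ [f' ef' ff']|f g _ [f' ef' ff'] _ [g' eg' gg']
  |f g ef [f' ef' ff'] eg [g' eg' gg']|f ef [f' ef' ff'] f0].
- exists (flat ('X^2 * (p - p^`()))); first exact: flat_base.
  exact: is_derive_flat.
- by exists (fun=> 0); [exact: flat_cst|move=> x; exact: is_derive_cst].
- exists (fun x => k * f' (k * x + c)).
    by apply: flat_mul; [exact: flat_cst|exact: flat_affine].
  move=> x; have da : is_derive x (1 : R) (fun y => k * y + c) k.
    apply: is_derive_eq (is_deriveD (is_deriveZ k (is_derive_id x 1))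
      (is_derive_cst c x 1)) _.
    by rewrite addr0 /GRing.scale/= mulr1.
  apply: is_derive_eq (@is_derive1_comp _ f _ x _ _ (ff' _) da) _.
  exact: mulrC.
- exists (fun x => f' x + g' x); first exact: flat_add.
  by move=> x; exact: is_deriveD.
- exists (fun x => f x * g' x + g x * f' x).
    by apply: flat_add; apply: flat_mul.
  by move=> x; exact: is_deriveM.
- exists (fun x => - 1 * ((f x)^-1 * (f x)^-1) * f' x).
    apply: flat_mul => //; apply: flat_mul; first exact: flat_cst.
    by apply: flat_mul; exact: flat_inv.
  move=> x; apply: is_derive_eq (is_deriveV (f0 x) (ff' x)) _.
  by rewrite /GRing.scale/= mulN1r -expr2 exprVn.
Qed.

Lemma flat_expr_smooth f : flat_expr f ->
  forall n x, derivable (derive1n n f) x 1.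
Proof.
move=> + n; elim: n f => [|n IH] f ef x.
  by have [f' _ /(_ x)[]] := flat_expr_derive ef.
have [f' ef' ff'] := flat_expr_derive ef.
rewrite derive1Sn (_ : derive1 f = f'); first exact: IH.
by apply/funext => y; rewrite derive1E; case: (ff' y).
Qed.

Definition smooth_step c d x : R :=
  flat 1 (x - c) / (flat 1 (x - c) + flat 1 (d - x)).

Lemma flat1_ge0 x : 0 <= flat 1 x.
Proof. by rewrite /flat; case: ifP => // _; rewrite hornerE mul1r expR_ge0. Qed.

Lemma flat1_gt0 x : 0 < x -> 0 < flat 1 x.
Proof. by rewrite /flat => ->; rewrite hornerE mul1r expR_gt0. Qed.

Lemma flat_le0 p x : x <= 0 -> flat p x = 0.
Proof. by rewrite /flat leNgt => /negbTE ->. Qed.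

Lemma flat1_nondecreasing x y : x <= y -> flat 1 x <= flat 1 y.
Proof.
move=> xy; have [x0|x0] := leP x 0; first by rewrite flat_le0// flat1_ge0.
rewrite /flat x0 (lt_le_trans x0 xy) !hornerE ?mul1r ler_expR lerN2.
by rewrite lef_pV2// posrE (lt_le_trans x0).
Qed.

Section step.
Variables c d : R.
Hypothesis cd : c < d.

Let denom_gt0 x : 0 < flat 1 (x - c) + flat 1 (d - x).
Proof.
have [cx|xc] := ltP c x; first by rewrite ltr_pwDl ?flat1_ge0// flat1_gt0// subr_gt0.
by rewrite ltr_wpDl ?flat1_ge0// flat1_gt0// subr_gt0 (le_lt_trans xc).
Qed.

Lemma flat_expr_step : flat_expr (smooth_step c d).
Proof.
have e1 : flat_expr (fun x => flat 1 (x - c)).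
  have := flat_affine 1 (- c) (flat_base 1).
  by congr flat_expr; apply/funext => x; rewrite mul1r.
have e2 : flat_expr (fun x => flat 1 (d - x)).
  have := flat_affine (- 1) d (flat_base 1).
  by congr flat_expr; apply/funext => x; rewrite mulN1r addrC.
apply: flat_mul => //; apply: flat_inv; first exact: flat_add.
by move=> x; rewrite gt_eqF.
Qed.

Lemma step_le x : x <= c -> smooth_step c d x = 0.
Proof. by move=> xc; rewrite /smooth_step flat_le0 ?mul0r// subr_le0. Qed.

Lemma step_ge x : d <= x -> smooth_step c d x = 1.
Proof.
move=> dx; rewrite /smooth_step [flat 1 (d - x)]flat_le0 ?subr_le0// addr0.
by rewrite divff// gt_eqF// flat1_gt0// subr_gt0 (lt_le_trans cd).
Qed.

Lemma step_ge0 x : 0 <= smooth_step c d x.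
Proof. by rewrite divr_ge0 ?addr_ge0 ?flat1_ge0. Qed.

Lemma step_le1 x : smooth_step c d x <= 1.
Proof. by rewrite ler_pdivrMr// mul1r lerDl flat1_ge0. Qed.

Lemma step_nondecreasing x y : x <= y -> smooth_step c d x <= smooth_step c d y.
Proof.
move=> xy; rewrite ler_pdivrMr// mulrAC ler_pdivlMr//.
rewrite !mulrDr [X in X + _ <= _]mulrC lerD2l.
by rewrite ler_pM ?flat1_ge0// flat1_nondecreasing// ?lerD2r// lerD2l lerN2.
Qed.

End step.

Lemma nondecreasing_is_derive_ge0 f x l : {homo f : y z / y <= z} ->
  is_derive x (1 : R) f l -> 0 <= l.
Proof.
move=> fnd /is_derive1_caratheodory[g [fg gx <-]]; rewrite leNgt.
apply/negP => gx0.
have : \forall y \near x, g y < 0 by exact: (cvgr_lt (g x) gx).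
rewrite -nbhs_nearE => /nbhs_ballP[e /= e0]; rewrite -ball_normE => /(_ (x + e / 2)).
rewrite /= opprD addNKr normrN ger0_norm ?divr_ge0 ?ltW// => /(_ _)/wrap[].
  lra.
have := fg (x + e / 2); rewrite addrAC subrr add0r => fge ge0.
have : 0 <= f (x + e / 2) - f x by rewrite subr_ge0 fnd// lerDl divr_ge0// ltW.
by rewrite fge pmulr_lge0 ?divr_gt0// leNgt ge0.
Qed.

End SmoothStep.

(** * Weak derivatives *)

Section WeakDerivatives.
Context {R : realType}.
Implicit Types (f g h : R -> R) (a b c d e k x : R).

Lemma step_derivative c d : c < d -> exists s' : R -> R,
  [/\ forall x, is_derive x (1 : R) (smooth_step c d) (s' x), continuous s',
      forall x, 0 <= s' x & forall x, (x < c) || (d < x) -> s' x = 0].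
Proof.
move=> cd; have [s' es' ss'] := flat_expr_derive (flat_expr_step cd).
exists s'; split=> // [x|x|x].
- have [s'' _ /(_ x)[]] := flat_expr_derive es'.
  by move=> /derivable1_diffP/differentiable_continuous.
- by apply: nondecreasing_is_derive_ge0 (ss' x); exact: step_nondecreasing.
- have locally_cst k : (\forall y \near x, smooth_step c d y = k) -> s' x = 0.
    move=> sk; have [_ <-] := ss' x.
    have [_ <-] := is_derive_cst (k : R^o) x (1 : R).
    exact: near_eq_derive.
  move=> /orP[xc|dx].
    apply: (locally_cst 0); near=> y; apply/step_le/ltW.
    by near: y; exact: lt_nbhsl.
  apply: (locally_cst 1); near=> y; apply/step_ge/ltW => //.
  by near: y; exact: lt_nbhsr.
Unshelve. all: by end_near. Qed.

(** The derivative of a step is nonnegative with integral one: it is an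
    approximate Dirac mass. *)
Lemma step_average c d f (s' : R -> R) k e : 0 <= c -> c < d -> d <= 1 ->
    (forall x, is_derive x (1 : R) (smooth_step c d) (s' x)) -> continuous s' ->
    (forall x, 0 <= s' x) -> (forall x, (x < c) || (d < x) -> s' x = 0) ->
    Linfty f -> (forall x, c <= x <= d -> `|f x - k| <= e) ->
  `|itg 0 1 (fun x => f x * s' x) - k| <= e.
Proof.
move=> c0 cd d1 ss' cs' s'0 s'out Lf fk.
have [Ls' Is'] := derivable_primitive ss' cs'.
have {}Is' : itg 0 1 s' = 1.
  by rewrite -Is'// step_ge// step_le// subr0.
have -> : itg 0 1 (fun x => f x * s' x) - k = itg 0 1 (fun x => (f x - k) * s' x).
  have -> : (fun x => (f x - k) * s' x) = (fun x => f x * s' x - k * s' x).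
    by apply/funext => x; rewrite mulrBl.
  by rewrite intB//; [rewrite intZ// Is' mulr1|exact: LinftyM|exact: LinftyZ].
have fks x : `|(f x - k) * s' x| <= e * s' x.
  rewrite normrM (ger0_norm (s'0 x)); have [xcd|] := boolP (c <= x <= d).
    by rewrite ler_wpM2r// fk.
  by rewrite negb_and -!ltNge => /s'out ->; rewrite !mulr0.
have L1 : Linfty (fun x => (f x - k) * s' x).
  by apply: LinftyM => //; apply: LinftyB => //; exact: Linfty_cst.
have -> : e = itg 0 1 (fun x => e * s' x) by rewrite intZ// Is' mulr1.
have L2 : Linfty (fun x => e * s' x) by exact: LinftyZ.
rewrite ler_norml -[- _]mulN1r -intZ// !int_le//; try exact: LinftyZ.
- by apply: ae01_all => x _ _; have := fks x; rewrite ler_norml => /andP[].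
- apply: ae01_all => x _ _; have := fks x; rewrite ler_norml => /andP[+ _].
  by rewrite mulN1r.
Qed.

Definition plateau c c' d' d x : R := smooth_step c c' x - smooth_step d' d x.

Lemma plateau_out c c' d' d x : c < c' -> c' <= d' -> d' < d ->
  (x <= c) || (d <= x) -> plateau c c' d' d x = 0.
Proof.
move=> cc' c'd' d'd /orP[xc|dx]; rewrite /plateau.
  by rewrite [smooth_step c _ _]step_le// step_le ?subrr//; lra.
by rewrite [smooth_step c _ _]step_ge ?step_ge ?subrr//; lra.
Qed.

Lemma plateau_in c c' d' d x : c < c' -> c' <= d' -> d' < d ->
  c' <= x <= d' -> plateau c c' d' d x = 1.
Proof.
by move=> cc' c'd' d'd /andP[cx xd]; rewrite /plateau step_ge// step_le// subr0.
Qed.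

Lemma plateau_bounded c c' d' d x : c < c' -> c' <= d' -> d' < d ->
  0 <= plateau c c' d' d x <= 1.
Proof.
move=> cc' c'd' d'd.
have := step_ge0 c c' x; have := step_le1 cc' x.
have := step_ge0 d' d x; have := step_le1 d'd x.
rewrite /plateau; have [xd|/ltW dx] := leP x d'.
  by rewrite [smooth_step d' d x]step_le//; lra.
by rewrite [smooth_step c c' x]step_ge//; lra.
Qed.

Lemma plateau_test c c' d' d : c < c' -> c' <= d' -> d' < d ->
  0 < c -> d < 1 -> test_function (plateau c c' d' d).
Proof.
move=> cc' c'd' d'd c0 d1.
have sub : closure [set x | plateau c c' d' d x != 0] `<=` `[c, d].
  have cl : closed (`[c, d] : set R) by exact: itv_closed.
  rewrite [X in _ `<=` X](closure_id _).1//; apply: closureS.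
  move=> x /=; rewrite in_itv/=; apply: contraR.
  rewrite negb_and -!ltNge => xcd; apply/eqP.
  apply: (plateau_out cc' c'd' d'd).
  by case/orP: xcd => /ltW ->//; rewrite orbT.
split.
- apply: flat_expr_smooth.
  have -> : plateau c c' d' d =
      (fun x => smooth_step c c' x + (- 1) * smooth_step d' d x).
    by apply/funext => x; rewrite mulN1r.
  apply: flat_add; first exact: flat_expr_step.
  by apply: flat_mul; [exact: flat_cst|exact: flat_expr_step].
- apply: subclosed_compact sub; first exact: closed_closure.
  exact: segment_compact.
- by apply: subset_trans sub _ => x /=; rewrite !in_itv/=; lra.
Qed.

(** The plateau and the indicator of [`]a, b[] differ only on the two ramps and
    the margins outside them. *)
Lemma plateau_average c c' d' d g M a b : c < c' -> c' <= d' -> d' < d ->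
    0 <= a -> a <= c -> d <= b -> b <= 1 ->
    Linfty g -> 0 <= M -> ae01 (fun x => `|g x| <= M) ->
  `|itg 0 1 (fun x => g x * plateau c c' d' d x) - itg a b g|
    <= M * ((c' - a) + (b - d')).
Proof.
move=> cc' c'd' d'd a0 ac db b1 Lg M0 gM.
set p := plateau c c' d' d.
have Lp : Linfty p.
  have [s' [ss' cs' _ _]] := step_derivative cc'.
  have [t' [tt' ct' _ _]] := step_derivative d'd.
  apply: LinftyB; apply: primitive_Linfty.
    exact: derivable_primitive ss' cs'.
  exact: derivable_primitive tt' ct'.
have Lgp : Linfty (fun x => g x * p x) by exact: LinftyM.
have Lr : Linfty (fun x => g x * p x - g x) by exact: LinftyB.
have [ac' c'b ad' d'b [ab a1 b0 c'0 d'1]] :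
  [/\ a <= c', c' <= b, a <= d', d' <= b & [/\ a <= b, a <= 1, 0 <= b, 0 <= c' & d' <= 1]].
  by split; [lra..|split; lra].
rewrite (@int_split _ 0 1 a)// (@int_split _ a 1 b)//.
rewrite (@int_eq _ 0 a (lexx 0) a1 (fun x => g x * p x) (fun=> 0))//; last 2 first.
- exact: Linfty_cst.
- by apply: ae01_all => x _ xa; rewrite /p plateau_out ?mulr0//; lra.
rewrite (@int_eq _ b 1 b0 (lexx 1) (fun x => g x * p x) (fun=> 0))//; last 2 first.
- exact: Linfty_cst.
- by apply: ae01_all => x _ xa; rewrite /p plateau_out ?mulr0//; lra.
rewrite !int_cst// !mul0r add0r addr0 -intB//.
rewrite (@int_split _ a b c')// (@int_split _ c' b d')//; try lra.
rewrite (@int_eq _ c' d' c'0 d'1 (fun x => g x * p x - g x) (fun=> 0))//; last 2 first.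
- exact: Linfty_cst.
- apply: ae01_all => x _ /andP[/ltW c'x /ltW xd'].
  by rewrite /p plateau_in ?c'x// mulr1 subrr.
rewrite int_cst//; try lra.
rewrite mul0r add0r (le_trans (ler_normD _ _))// mulrDr lerD//.
- apply: int_norm_le => //; first lra.
  apply: ae01W gM => x _ gM _.
  have := plateau_bounded x cc' c'd' d'd; rewrite -/p => p01.
  rewrite -[X in _ - X]mulr1 -mulrBr normrM -[leRHS]mulr1 ler_pM//.
  by rewrite distrC ger0_norm; lra.
- apply: int_norm_le => //; first lra.
  apply: ae01W gM => x _ gM _.
  have := plateau_bounded x cc' c'd' d'd; rewrite -/p => p01.
  rewrite -[X in _ - X]mulr1 -mulrBr normrM -[leRHS]mulr1 ler_pM//.
  by rewrite distrC ger0_norm; lra.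
Qed.

Lemma within_continuous_dist f x e : {within `[0, 1], continuous f} ->
  0 <= x <= 1 -> 0 < e -> exists2 r, 0 < r &
  forall y, 0 <= y <= 1 -> `|y - x| < r -> `|f y - f x| <= e.
Proof.
move=> /subspace_continuousP cf x01 e0.
have := cf x; rewrite /= in_itv/= => /(_ x01) /cvgrPdist_le /(_ e e0).
rewrite near_withinE => /nbhs_ballP[r /= r0 rP]; exists r => // y y01 yx.
by rewrite distrC; apply: rP; rewrite ?in_itv//= /ball/= distrC.
Qed.

(** The derivative of a plateau is the difference of two approximate Dirac
    masses, one near [a] and one near [b], so that the left side of the weak
    formula is close to [f a - f b], while its right side is close to the
    opposite of the integral of [g] over [`]a, b[]. *)
Lemma weak_derivative_primitive f g :
    {within `[0, 1], continuous f} -> Linfty g ->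
    (forall phi, test_function phi ->
      itg 0 1 (fun x => f x * derive1 phi x) = - itg 0 1 (fun x => g x * phi x)) ->
  primitive01 f g.
Proof.
move=> cf Lg weak; split=> // a b a0.
rewrite le_eqVlt => /predU1P[->|ab] b1; first by rewrite set_itvoo0 Rintegral_set0 subrr.
have Lf := Linfty_continuous cf.
have [_ [M0 gM0]] := Lg; pose M := `|M0|.
have gM : ae01 (fun x => `|g x| <= M).
  by apply: ae01W gM0 => x _ gM0x; rewrite (le_trans gM0x)// ler_norm.
suff main e : 0 < e -> `|f b - f a - itg a b g| <= (2 + M) * e.
  apply/eqP; rewrite -subr_eq0 -normr_le0; apply/ler_addgt0Pl => e e0; rewrite addr0.
  have M2 : 0 < 2 + M by rewrite ltr_wpDr ?normr_ge0.
  have := main (e / (2 + M)); rewrite divr_gt0// => /(_ isT).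
  by rewrite [X in _ <= X]mulrC divfK// gt_eqF.
move=> e0; have a01 : 0 <= a <= 1 by lra.
have b01 : 0 <= b <= 1 by lra.
have [ra ra0 fa] := within_continuous_dist cf a01 e0.
have [rb rb0 fb] := within_continuous_dist cf b01 e0.
(* two margins and two ramps of width [h] fit in [`]a, b[], they stay in the
   neighbourhoods where [f] is nearly constant, and they carry at most [M * e]
   of the integral of [g] *)
pose h := Num.min (Num.min ra rb) (Num.min (b - a) e) / 4.
have [h0 hra hrb hab he] : [/\ 0 < h, h * 4 <= ra, h * 4 <= rb,
    h * 4 <= b - a & h * 4 <= e].
  rewrite /h divfK// !ge_min !lexx !orbT; split=> //.
  by rewrite divr_gt0// !lt_min ra0 rb0 e0 subr_gt0 ab.
pose c := a + h; pose c' := a + 2 * h; pose d' := b - 2 * h; pose d := b - h.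
have cc' : c < c' by rewrite /c /c'; lra.
have c'd' : c' <= d' by rewrite /c' /d'; lra.
have d'd : d' < d by rewrite /d /d'; lra.
have [s' [ss' cs' s'0 s'out]] := step_derivative cc'.
have [t' [tt' ct' t'0 t'out]] := step_derivative d'd.
have [Ls' _] := derivable_primitive ss' cs'.
have [Lt' _] := derivable_primitive tt' ct'.
have Is : `|itg 0 1 (fun x => f x * s' x) - f a| <= e.
  apply: step_average cc' _ ss' cs' s'0 s'out Lf _.
  - by rewrite /c; lra.
  - by rewrite /c'; lra.
  - move=> x; rewrite /c /c' => xcc'; apply: fa; first lra.
    by rewrite ger0_norm; lra.
have It : `|itg 0 1 (fun x => f x * t' x) - f b| <= e.
  apply: step_average d'd _ tt' ct' t'0 t'out Lf _.
  - by rewrite /d'; lra.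
  - by rewrite /d; lra.
  - move=> x; rewrite /d /d' => xcc'; apply: fb; first lra.
    by rewrite ler0_norm; lra.
have [c0 d1 ac db] : [/\ 0 < c, d < 1, a <= c & d <= b].
  by split; rewrite /c /d; lra.
have := weak _ (plateau_test cc' c'd' d'd c0 d1).
have -> : derive1 (plateau c c' d' d) = (fun x => s' x - t' x).
  apply/funext => x; rewrite derive1E.
  by have [_ <-] := is_deriveB (ss' x) (tt' x).
have -> : (fun x => f x * (s' x - t' x)) = (fun x => f x * s' x - f x * t' x).
  by apply/funext => x; rewrite mulrBr.
rewrite intB//; [move=> Ist|exact: LinftyM|exact: LinftyM].
have := plateau_average cc' c'd' d'd a0 ac db b1 Lg (normr_ge0 _) gM.
have -> : (c' - a) + (b - d') = h * 4 by rewrite /c' /d'; ring.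
move=> Ig; have {}Ig := le_trans Ig (ler_wpM2l (normr_ge0 _) he).
move: Is It Ig Ist; rewrite -/M mulrDl !ler_norml; lra.
Qed.

End WeakDerivatives.

(** * Modes on the imaginary axis *)

Section ImaginaryModes.
Context {R : realType}.
Implicit Types (f g u B phi : R -> R) (a b k x beta omega s : R).

Lemma test_function_primitive phi : test_function phi ->
  [/\ primitive01 phi (derive1 phi), phi 0 = 0 & phi 1 = 0].
Proof.
move=> [dphi _ sphi].
have out x : ~ (0 < x < 1) -> phi x = 0.
  move=> x01; apply/eqP/negPn/negP => phix; apply: x01.
  have /sphi : closure [set x | phi x != 0] x by exact: subset_closure.
  by rewrite /= in_itv.
split; [|apply: out; lra|apply: out; lra].
apply: derivable_primitive.
  by move=> x; rewrite derive1E; exact: derivableP (dphi 0%N x).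
by move=> x; exact/differentiable_continuous/derivable1_diffP/(dphi 1%N x).
Qed.

Lemma primitive_weak_derivative f g phi : primitive01 f g -> test_function phi ->
  itg 0 1 (fun x => f x * derive1 phi x) = - itg 0 1 (fun x => g x * phi x).
Proof.
move=> pf /test_function_primitive[pphi phi0 phi1].
have [_] := primitiveM pf pphi.
move=> /(_ 0 1 (lexx 0) ler01 (lexx 1)); rewrite phi0 phi1 !mulr0 subrr.
have Lf := primitive_Linfty pf; have Lphi := primitive_Linfty pphi.
have [Lg _] := pf; have [Lphi' _] := pphi.
rewrite intD//; [|exact: LinftyM|exact: LinftyM].
by move=> /esym/eqP; rewrite addr_eq0 => /eqP ->; rewrite opprK.
Qed.

Lemma ReN (z : R[i]) : complex.Re (- z) = - complex.Re z.
Proof. by case: z. Qed.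

Lemma ImN (z : R[i]) : complex.Im (- z) = - complex.Im z.
Proof. by case: z. Qed.

Lemma ReM_real (z : R[i]) k : complex.Re (z * k%:C) = complex.Re z * k.
Proof. by case: z => a b /=; rewrite mulr0 subr0. Qed.

Lemma ImM_real (z : R[i]) k : complex.Im (z * k%:C) = complex.Im z * k.
Proof. by case: z => a b /=; rewrite mulr0 add0r. Qed.

Lemma weak_derivativeP (y y1 : R -> R[i]) : continuous01 y -> LinftyC y1 ->
  weak_derivative y y1 <->
  primitive01 (fun x => complex.Re (y x)) (fun x => complex.Re (y1 x)) /\
  primitive01 (fun x => complex.Im (y x)) (fun x => complex.Im (y1 x)).
Proof.
move=> [cRe cIm] [LRe LIm].
have eRe (w : R -> R[i]) (h : R -> R) :
    complex.Re (integral01 (fun x => w x * (h x)%:C)) =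
    itg 0 1 (fun x => complex.Re (w x) * h x).
  by rewrite /integral01 /=; congr Rintegral; apply/funext => x; exact: ReM_real.
have eIm (w : R -> R[i]) (h : R -> R) :
    complex.Im (integral01 (fun x => w x * (h x)%:C)) =
    itg 0 1 (fun x => complex.Im (w x) * h x).
  by rewrite /integral01 /=; congr Rintegral; apply/funext => x; exact: ImM_real.
split=> [weak|[pRe pIm] phi tphi].
  split; apply: weak_derivative_primitive => // phi /weak.
    by move=> /(congr1 (@complex.Re R)); rewrite ReN !eRe.
  by move=> /(congr1 (@complex.Im R)); rewrite ImN !eIm.
apply/eqP; rewrite eq_complex; apply/andP; split; apply/eqP.
  by rewrite ReN !eRe; exact: primitive_weak_derivative.
by rewrite ImN !eIm; exact: primitive_weak_derivative.
Qed.

(** The equation is built in by taking [beta ^+ 2 * B x * u x] as the derivative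
    of [u1], so that identities between integrands can be checked pointwise. *)
Record imaginary_mode B beta u u1 : Prop := ImaginaryMode {
  mode_beta : beta != 0;
  mode_u : primitive01 u u1;
  mode_u1 : primitive01 u1 (fun x => beta ^+ 2 * B x * u x);
  mode_left : u1 0 = 0;
  mode_right : u1 1 = beta * u 1;
  mode_neq0 : exists2 x, 0 <= x <= 1 & u x != 0 }.

Lemma sqr_imaginary beta : (0 +i* beta) ^+ 2 = (- beta ^+ 2)%:C.
Proof.
by apply/eqP; rewrite expr2 eq_complex/= !mul0r !mulr0 sub0r addr0 !eqxx.
Qed.

Lemma div_imaginary (z : R[i]) beta : beta != 0 ->
  (0 +i* 1) * z / (0 +i* beta) = z * (beta^-1)%:C.
Proof.
move=> beta0; have k0 : (0 +i* beta) != 0 :> R[i].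
  by rewrite eq_complex/= negb_and beta0 orbT.
apply: (mulIf k0); rewrite divfK//; case: z => a b.
apply/eqP; rewrite eq_complex/=; apply/andP; split; apply/eqP; field.
  exact: beta0.
exact: beta0.
Qed.

Lemma imaginary_eq0 beta : ((0 +i* beta) == 0 :> R[i]) = (beta == 0).
Proof. by rewrite eq_complex/= eqxx. Qed.

(** Since the equation and the boundary conditions are real on the imaginary
    axis, the real or the imaginary part of a mode is again a mode. *)
Lemma quasi_eigenvalue_mode B beta : Linfty B ->
  quasi_eigenvalue B (0 +i* beta) <-> exists u u1, imaginary_mode B beta u u1.
Proof.
move=> LB; split.
- rewrite /quasi_eigenvalue imaginary_eq0 => -[beta0 [y [y1 [y2 []]]]].
  move=> [[Ly Ly1 Ly2] [wy wy1 cy cy1]] [x x01 yx] eqn y10 yr.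
  have [pRe pIm] := (weak_derivativeP cy Ly1).1 wy.
  have [pRe1 pIm1] := (weak_derivativeP cy1 Ly2).1 wy1.
  have eRe : ae01 (fun x => complex.Re (y2 x) = beta ^+ 2 * B x * complex.Re (y x)).
    apply: ae01W eqn => t _; rewrite sqr_imaginary.
    move=> /(congr1 (@complex.Re R)); case: (y2 t) => a b; case: (y t) => c d /=.
    by lra.
  have eIm : ae01 (fun x => complex.Im (y2 x) = beta ^+ 2 * B x * complex.Im (y x)).
    apply: ae01W eqn => t _; rewrite sqr_imaginary.
    move=> /(congr1 (@complex.Im R)); case: (y2 t) => a b; case: (y t) => c d /=.
    by lra.
  have LBf f : Linfty f -> Linfty (fun x => beta ^+ 2 * B x * f x).
    by move=> Lf; apply: LinftyM => //; exact: LinftyZ.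
  have [LyRe LyIm] := Ly.
  have {}pRe1 := primitive_ae (LBf _ LyRe) eRe pRe1.
  have {}pIm1 := primitive_ae (LBf _ LyIm) eIm pIm1.
  have y11 : y1 1 = y 1 * beta%:C.
    move: yr; rewrite div_imaginary// => /eqP; rewrite subr_eq0 => /eqP ->.
    by rewrite -mulrA -rmorphM/= mulVf// mulr1.
  rewrite in_itv/= in x01.
  have [yRe|yRe] := eqVneq (complex.Re (y x)) 0.
    exists (fun x => complex.Im (y x)), (fun x => complex.Im (y1 x)); split=> //.
    + by rewrite y10.
    + by rewrite y11 ImM_real mulrC.
    + by exists x => //; move: yx; rewrite eq_complex/= yRe eqxx.
  exists (fun x => complex.Re (y x)), (fun x => complex.Re (y1 x)); split=> //.
  + by rewrite y10.
  + by rewrite y11 ReM_real mulrC.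
  + by exists x.
- move=> [u [u1 [beta0 pu pu1 u10 u11 [x x01 ux]]]]; split.
    by rewrite imaginary_eq0.
  pose u2 x := beta ^+ 2 * B x * u x.
  exists (fun x => (u x)%:C), (fun x => (u1 x)%:C), (fun x => (u2 x)%:C).
  have p0 : primitive01 (fun=> 0 : R) (fun=> 0).
    split; first exact: Linfty_cst.
    by move=> a b a0 ab b1; rewrite int_cst// mul0r subrr.
  have cc f g : primitive01 f g -> continuous01 (fun x => (f x)%:C).
    move=> pf; split=> /=; first exact: primitive_continuous pf.
    exact: primitive_continuous p0.
  have LL f : Linfty f -> LinftyC (fun x => (f x)%:C).
    by move=> Lf; split => //; exact: Linfty_cst.
  have Lu := primitive_Linfty pu; have Lu1 := primitive_Linfty pu1.
  have [Lu2 _] := pu1.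
  split.
  + split; first by split; exact: LL.
    split; [| |exact: cc pu|exact: cc pu1].
      by apply/weak_derivativeP => //; [exact: cc pu|exact: LL].
    by apply/weak_derivativeP => //; [exact: cc pu1|exact: LL].
  + by exists x; rewrite ?in_itv//= eq_complex/= negb_and ux.
  + apply: ae01_all => t _; rewrite sqr_imaginary -!rmorphM -rmorphD/=.
    by rewrite /u2 !mulNr addrN.
  + by rewrite u10.
  + rewrite div_imaginary// u11 -rmorphM/= mulrAC mulfV// mul1r subrr//.
Qed.

(** Testing the equation against [u] shows that [beta * u 1 ^+ 2] is the
    integral of [u1 ^+ 2 + beta ^+ 2 * B * u ^+ 2]. If this integral were not
    positive, [u1] would vanish almost everywhere, and [u] would be the constant
    [u 1 = 0]. *)
Lemma mode_energy B beta u u1 : ae01 (fun x => 0 <= B x) ->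
  imaginary_mode B beta u u1 -> 0 < beta /\ u 1 != 0.
Proof.
move=> B0 [beta0 pu pu1 u10 u11 [x x01 ux]].
suff : 0 < beta * u 1 ^+ 2.
  have [->|u1_neq0] := eqVneq (u 1) 0; first by rewrite expr0n/= mulr0 ltxx.
  by rewrite pmulr_lgt0// exprn_even_gt0.
pose q x := u1 x * u1 x + u x * (beta ^+ 2 * B x * u x).
have [Lq Iq] : primitive01 (fun x => u x * u1 x) q by exact: primitiveM.
have {}Iq : itg 0 1 q = beta * u 1 ^+ 2.
  by rewrite -Iq// u10 u11 mulr0 subr0; ring.
have q_ge t : 0 <= B t -> u1 t ^+ 2 <= q t.
  move=> Bt; rewrite /q (_ : _ + _ = u1 t ^+ 2 + (beta * u t) ^+ 2 * B t).
    by rewrite lerDl mulr_ge0// sqr_ge0.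
  by ring.
have q0 : ae01 (fun x => 0 <= q x).
  by apply: ae01W B0 => t _ /q_ge; exact: le_trans (sqr_ge0 _).
have Iq0 : 0 <= itg 0 1 q.
  by apply: int_ge0 => //; apply: ae01W q0 => t _ q0t _.
rewrite -Iq lt_neqAle Iq0 andbT; apply/eqP => /esym Iqz.
have /eqP := Iq; rewrite Iqz eq_sym mulf_eq0 (negbTE beta0)/= sqrf_eq0 => /eqP u1z.
have qz := int_ge0_eq0 Lq q0 Iqz.
have u1_ae0 : ae01 (fun x => u1 x = 0).
  apply: ae01W2 B0 qz => t _ /q_ge + qt; rewrite qt => u1t.
  by apply/eqP; rewrite -sqrf_eq0 eq_le u1t sqr_ge0.
have [_ pu0] := primitive_ae (Linfty_cst 0) u1_ae0 pu.
move/andP: x01 => [x0 x1]; have := pu0 x 1 x0 x1 (lexx 1).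
by rewrite int_cst// mul0r u1z sub0r => /eqP; rewrite oppr_eq0 (negbTE ux).
Qed.

(** Twice the hyperbolic cosine of [omega * x], and its derivative. *)
Definition zmode omega x : R := expR (omega * x) + expR (- omega * x).
Definition zmode' omega x : R :=
  omega * (expR (omega * x) - expR (- omega * x)).

Lemma zmode_gt0 omega x : 0 < zmode omega x.
Proof. by rewrite addr_gt0// expR_gt0. Qed.

Lemma is_derive_expRZ k x : is_derive x (1 : R) (fun t => expR (k * t))
  (k * expR (k * x)).
Proof.
have da : is_derive x (1 : R) (fun t => k * t) k.
  apply: is_derive_eq (is_deriveZ k (is_derive_id x 1)) _.
  by rewrite /GRing.scale/= mulr1.
apply: is_derive_eq (@is_derive1_comp _ expR _ x _ _ (is_derive_expR _) da) _.
exact: mulrC.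
Qed.

Lemma expRZ_primitive k :
  primitive01 (fun x : R => expR (k * x)) (fun x => k * expR (k * x)).
Proof.
apply: derivable_primitive; first exact: is_derive_expRZ.
move=> x; apply/differentiable_continuous/derivable1_diffP.
have [//] : is_derive x (1 : R) (fun t => k * expR (k * t)) (k * (k * expR (k * x))).
exact: (is_deriveZ k (is_derive_expRZ k x)).
Qed.

Lemma zmode_primitive omega :
  primitive01 (zmode omega) (zmode' omega) /\
  primitive01 (zmode' omega) (fun x => omega ^+ 2 * zmode omega x).
Proof.
have p1 := expRZ_primitive omega; have p2 := expRZ_primitive (- omega).
split.
  have := primitiveD p1 p2; congr primitive01; apply/funext => x.
  by rewrite /zmode'; ring.
have := primitiveZ omega (primitiveD p1 (primitiveZ (-1) p2)).
congr primitive01; apply/funext => x; rewrite /zmode /zmode'; ring.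
Qed.

(** Let [v] be the multiple of [zmode omega] with [v 1 = u 1]. Its energy for
    the coefficient [b2] exceeds the energy of [u] for [B], because [u]
    minimizes the latter among the functions with the same value at [1] and
    [B <= b2]. The integrand [q] below writes the excess as a sum of nonnegative
    terms, the last of which can only vanish where [B = b2]. *)
Lemma mode_comparison B b2 beta u u1 : 0 <= b2 -> ae01 (fun x => 0 <= B x <= b2) ->
  imaginary_mode B beta u u1 ->
  let omega := beta * Num.sqrt b2 in
  beta * zmode omega 1 <= zmode' omega 1 /\
  (beta * zmode omega 1 = zmode' omega 1 -> ae01 (fun x => B x = b2)).
Proof.
move=> b20 B0b mode omega.
have B0 : ae01 (fun x => 0 <= B x) by apply: ae01W B0b => x _ /andP[].
have [beta_gt0 u1_neq0] := mode_energy B0 mode.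
have [beta0 pu pu1 u10 u11 _] := mode.
have omega2 : omega ^+ 2 = beta ^+ 2 * b2 by rewrite exprMn sqr_sqrtr.
have [pz pz'] := zmode_primitive omega.
pose c := u 1 / zmode omega 1.
pose v x := c * zmode omega x; pose v1 x := c * zmode' omega x.
have pv : primitive01 v v1 by exact: primitiveZ.
have pv1 : primitive01 v1 (fun x => beta ^+ 2 * b2 * v x).
  have := primitiveZ c pz'; congr primitive01; apply/funext => x.
  by rewrite omega2 /v; ring.
have c0 : c != 0 by rewrite mulf_neq0// invr_neq0// gt_eqF// zmode_gt0.
have v_neq0 x : v x != 0 by rewrite mulf_neq0// gt_eqF// zmode_gt0.
have v1E : v 1 = u 1 by rewrite /v divfK// gt_eqF// zmode_gt0.
have v10 : v1 0 = 0 by rewrite /v1 /zmode' !mulr0 subrr !mulr0.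
pose q x := (v1 x - u1 x) ^+ 2 + beta ^+ 2 * B x * (v x - u x) ^+ 2
  + beta ^+ 2 * (b2 - B x) * v x ^+ 2.
(* integrating by parts the energies of [v] and [u] and their cross term *)
have [Lq Iq] : primitive01
    (fun x => v x * v1 x + ((- 2) * (v x * u1 x) + u x * u1 x)) q.
  have := primitiveD (primitiveM pv pv1)
    (primitiveD (primitiveZ (- 2) (primitiveM pv pu1)) (primitiveM pu pu1)).
  by congr primitive01; apply/funext => x; rewrite /q; ring.
have q_ge x : 0 <= B x <= b2 -> beta ^+ 2 * (b2 - B x) * v x ^+ 2 <= q x.
  move=> /andP[B0x Bb]; rewrite lerDr addr_ge0 ?sqr_ge0//.
  by rewrite mulr_ge0 ?sqr_ge0// mulr_ge0 ?sqr_ge0.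
have q0 : ae01 (fun x => 0 <= q x).
  apply: ae01W B0b => x _ B0bx; apply: le_trans (q_ge _ B0bx).
  by rewrite mulr_ge0 ?sqr_ge0// mulr_ge0 ?sqr_ge0// subr_ge0; case/andP: B0bx.
have {}Iq : itg 0 1 q * zmode omega 1 =
    u 1 ^+ 2 * (zmode' omega 1 - beta * zmode omega 1).
  rewrite -Iq// u10 v10 u11 v1E /v1 /c; field.
  by rewrite gt_eqF// zmode_gt0.
have u2_gt0 : 0 < u 1 ^+ 2 by rewrite exprn_even_gt0.
split.
  rewrite -subr_ge0 -(pmulr_rge0 _ u2_gt0) -Iq mulr_ge0 ?(ltW (zmode_gt0 _ _))//.
  by apply: int_ge0 => //; apply: ae01W q0 => x _ + _.
move=> E; have /int_ge0_eq0 : itg 0 1 q = 0.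
  apply: (mulIf (lt0r_neq0 (zmode_gt0 omega 1))).
  by rewrite Iq E subrr mulr0 mul0r.
move=> /(_ Lq q0); apply: ae01W2 B0b => x _ B0bx qx.
have := q_ge _ B0bx; rewrite qx => le0.
have : beta ^+ 2 * (b2 - B x) * v x ^+ 2 = 0.
  apply/eqP; rewrite eq_le le0/= mulr_ge0 ?sqr_ge0// mulr_ge0 ?sqr_ge0// subr_ge0.
  by case/andP: B0bx.
move=> /eqP; rewrite mulf_eq0 sqrf_eq0 (negbTE (v_neq0 _)) orbF.
rewrite mulf_eq0 sqrf_eq0 (negbTE beta0)/=.
by rewrite subr_eq0 eq_sym => /eqP.
Qed.

(** For [beta] positive, the sign of the last factor decides the comparison of
    [mode_comparison]. *)
Lemma zmode_balance beta s :
  beta * zmode (beta * s) 1 - zmode' (beta * s) 1 =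
  beta * expR (- (beta * s)) * ((s + 1) - (s - 1) * expR (2 * beta * s)).
Proof.
rewrite /zmode /zmode' !mulr1.
have -> : expR (2 * beta * s) = expR (beta * s) * expR (beta * s).
  by rewrite -expRD; congr expR; ring.
have e : expR (- (beta * s)) * expR (beta * s) = 1.
  by rewrite mulrC expRxMexpNx_1.
set P := expR (beta * s) in e *; set N := expR (- _) in e *.
transitivity (beta * (N * (s + 1) - (s - 1) * P * (N * P))); last by ring.
by rewrite e; ring.
Qed.

End ImaginaryModes.

(** * The minimal decay rate at zero frequency *)

Section MinimalDecay.
Context {R : realType}.
Implicit Types (b beta s : R) (B : R -> R).

Definition optimal_decay b2 : R :=
  (2 * Num.sqrt b2)^-1 * ln ((Num.sqrt b2 + 1) / (Num.sqrt b2 - 1)).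

Let sqrt_gt1 b : 1 < b -> 1 < Num.sqrt b :> R.
Proof. by move=> b1; rewrite -sqrtr1 ltr_sqrt// (lt_trans _ b1). Qed.

Lemma expR_optimal_decay b2 : 1 < b2 ->
  expR (2 * optimal_decay b2 * Num.sqrt b2) = (Num.sqrt b2 + 1) / (Num.sqrt b2 - 1).
Proof.
move=> b21; set s := Num.sqrt b2; have s1 : 1 < s by exact: sqrt_gt1.
rewrite -[RHS]lnK; last by rewrite posrE divr_gt0//; lra.
by congr expR; rewrite /optimal_decay -/s; field; lra.
Qed.

Lemma optimal_decay_gt0 b2 : 1 < b2 -> 0 < optimal_decay b2.
Proof.
move=> b21; have s1 := sqrt_gt1 b21.
rewrite mulr_gt0 ?invr_gt0 ?mulr_gt0//; first lra.
by rewrite ln_gt0// ltr_pdivlMr; lra.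
Qed.

Lemma imaginary_quasi_eigenvalue b1 b2 B beta : 0 <= b1 -> 0 < b2 ->
  Ad b1 b2 B -> K B (0 +i* beta) -> [/\ 1 < b2, optimal_decay b2 <= beta &
    beta = optimal_decay b2 -> ae01 (fun x => B x = b2)].
Proof.
move=> b10 b20 [LB Bb] /(quasi_eigenvalue_mode _ LB)[u [u1 mode]].
have B0b : ae01 (fun x => 0 <= B x <= b2).
  by apply: ae01W Bb => x _ /andP[b1B ->]; rewrite (le_trans b10).
have [|beta0 _] := mode_energy _ mode; first by apply: ae01W B0b => x _ /andP[].
have [le eq] := mode_comparison (ltW b20) B0b mode.
have s0 : 0 < Num.sqrt b2 by rewrite sqrtr_gt0.
have bal := zmode_balance beta (Num.sqrt b2).
set s := Num.sqrt b2 in s0 le eq bal.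
have sE : s + 1 <= (s - 1) * expR (2 * beta * s).
  have N0 : 0 < beta * expR (- (beta * s)) by rewrite mulr_gt0// expR_gt0.
  by rewrite -subr_le0 -(pmulr_rle0 _ N0) -bal subr_le0.
have s1 : 1 < s.
  rewrite ltNge; apply/negP => s1; have := expR_gt0 (2 * beta * s).
  by nra.
have b21 : 1 < b2.
  by rewrite -(sqr_sqrtr (ltW b20)) exprn_egt1.
have E := expR_optimal_decay b21; rewrite -/s in E.
split=> //.
  have : expR (2 * optimal_decay b2 * s) <= expR (2 * beta * s).
    by rewrite E ler_pdivrMr ?subr_gt0// mulrC.
  rewrite ler_expR ler_pM2r// ler_pM2l//.
move=> betaE; apply: eq; apply/eqP; rewrite -subr_eq0 bal betaE E.
by rewrite mulrCA divff ?mulr1 ?subrr ?mulr0// subr_eq0 gt_eqF.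
Qed.

Lemma constant_quasi_eigenvalue b2 B : 1 < b2 -> Linfty B ->
  ae01 (fun x => B x = b2) -> K B (0 +i* optimal_decay b2).
Proof.
move=> b21 LB Bb; apply/quasi_eigenvalue_mode => //.
have beta0 := optimal_decay_gt0 b21; have s1 := sqrt_gt1 b21.
set beta := optimal_decay b2 in beta0 *; set s := Num.sqrt b2 in s1.
have [pz pz'] := zmode_primitive (beta * s).
exists (zmode (beta * s)), (zmode' (beta * s)); split=> //.
- by rewrite gt_eqF.
- apply: primitive_ae pz'.
    by apply: LinftyM; [exact: LinftyZ|exact: primitive_Linfty pz].
  apply: ae01W Bb => x _ ->; rewrite exprMn sqr_sqrtr//.
  by rewrite ltW// (lt_trans _ b21).
- by rewrite /zmode' !mulr0 subrr mulr0.
- apply/esym/eqP; rewrite -subr_eq0 zmode_balance /beta /s.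
  rewrite expR_optimal_decay// mulrCA divff ?mulr1 ?subrr ?mulr0//.
  by rewrite subr_eq0 gt_eqF// sqrt_gt1.
- by exists 0; rewrite ?lexx ?ler01// gt_eqF// zmode_gt0.
Qed.

End MinimalDecay.

Theorem theorem2p5 (R : realType) (b1 b2 : R)
  (hb1 : 0 <= b1) (hb12 : b1 <= b2) (hb2 : 0 < b2) :
  (b2 <= 1 -> minimal_decay b1 b2 0 = +oo%E) /\
  (1 < b2 ->
    minimal_decay b1 b2 0
      = ((2 * Num.sqrt b2)^-1
         * ln ((Num.sqrt b2 + 1) / (Num.sqrt b2 - 1)))%:E /\
    forall B : R -> R, Ad b1 b2 B ->
      (K B (0 +i* fine (minimal_decay b1 b2 0)) <-> ae01 (fun x => B x = b2))).
Proof.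
have rates r : decay_rates b1 b2 0 r ->
    exists2 B, Ad b1 b2 B & K B (0 +i* r).
  move=> [[a b]] [/= a0 [B AdB KB]] br; exists B => //.
  by rewrite -a0 -br.
split=> [b21|b21].
  rewrite /minimal_decay asboolT// -subset0 => r /rates[B AdB KB].
  by have [] := imaginary_quasi_eigenvalue hb1 hb2 AdB KB; rewrite ltNge b21.
rewrite -/(optimal_decay b2).
have Adb2 : Ad b1 b2 (fun=> b2).
  by split; [exact: Linfty_cst|apply: ae01_all => x _; rewrite hb12 lexx].
have minb2 : is_min (decay_rates b1 b2 0) (optimal_decay b2).
  split=> [|r /rates[B AdB KB]].
    exists (0 +i* optimal_decay b2) => //; split=> //; exists (fun=> b2) => //.
    by apply: constant_quasi_eigenvalue => //; [exact: Linfty_cst|exact: ae01_all].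
  by have [] := imaginary_quasi_eigenvalue hb1 hb2 AdB KB.
have -> : minimal_decay b1 b2 0 = (optimal_decay b2)%:E.
  rewrite /minimal_decay asboolF; last first.
    by move=> S0; have [] := minb2; rewrite S0.
  congr EFin; apply: xget_unique => // r [Sr lbr].
  by apply/eqP; rewrite eq_le lbr ?(minb2.2 r)//; exact: minb2.1.
split=> // B AdB; split=> [KB|Bb].
  by have [_ _] := imaginary_quasi_eigenvalue hb1 hb2 AdB KB; apply.
by apply: constant_quasi_eigenvalue => //; case: AdB.
Qed.
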